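(* Let $n \geqslant 4$ be even. Then for every $k = 0, 1, \ldots, n$, $$c_k(A_{n,n/2}) \leqslant c_k(A_{n,n/2-1}) \leqslant \cdots \leqslant c_k(A_{n,3}) \leqslant c_k(A_{n,2}) = c_k(P_n).$$
   Context: For a simple graph $G$ on $n$ vertices with Laplacian matrix $L(G) = D(G) - A(G)$, the Laplacian coefficients $c_0(G), \ldots, c_n(G)$ are defined by $\det(\lambda I_n - L(G)) = \sum_{k=0}^n (-1)^k c_k(G) \lambda^{n-k}$. $P_n$ denotes the path on $n$ vertices. For $n$ even and $2 \leqslant \Delta \leqslant n/2$, $A_{n,\Delta}$ is the starlike tree on $n$ vertices consisting of a central vertex $v$, a pendent edge, a pendent path of length $n - 2\Delta + 2$, and $\Delta - 2$ pendent paths of length $2$, all attached at $v$ (lengths count edges). *)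

(* Defs.v *)
From HB Require Import structures.
From mathcomp Require Import all_boot all_order all_algebra.
From mathcomp Require Import zify.
Set Implicit Arguments.
Unset Strict Implicit.
Unset Printing Implicit Defensive.
Import Order.TTheory GRing.Theory Num.Theory.
Local Open Scope ring_scope.

Record sgraph := SGraph {
  vertex :> finType;
  adj : rel vertex;
  adj_sym : symmetric adj;
  adj_irrefl : irreflexive adj }.

Definition degree (G : sgraph) (v : G) : nat := #|[set u | adj v u]|.

(* Matrices are indexed by 'I_#|G|; [enum_val] numbers the vertices. The
   characteristic polynomial does not depend on the numbering. *)
Definition adjacency_mx (G : sgraph) : 'M[int]_#|G| :=
  \matrix_(i, j) (adj (enum_val i) (enum_val j))%:R.

Definition degree_mx (G : sgraph) : 'M[int]_#|G| :=
  diag_mx (\row_i (degree (enum_val i))%:R).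

Definition laplacian (G : sgraph) : 'M[int]_#|G| :=
  degree_mx G - adjacency_mx G.

(* Solves the defining identity [char_poly_laplacian] below for c_k; it is
   meaningful only for k <= #|G|, since the subtraction on nat truncates. *)
Definition laplacian_coef (G : sgraph) (k : nat) : int :=
  (-1) ^+ k * (char_poly (laplacian G))`_(#|G| - k).

Lemma char_poly_laplacian (G : sgraph) :
  char_poly (laplacian G) =
    \sum_(k < #|G|.+1)
      ((-1) ^+ k * laplacian_coef G k) *: 'X^(#|G| - k).
Proof.
rewrite -[LHS]coefK poly_def size_char_poly (reindex_inj rev_ord_inj) /=.
apply: eq_bigr => k _.
by rewrite /laplacian_coef mulrA -exprMn mulrNN mul1r expr1n mul1r subSS.
Qed.

Definition path_adj (n : nat) : rel 'I_n :=
  fun i j => (i.+1 == j :> nat) || (j.+1 == i :> nat).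

Lemma path_adj_sym n : symmetric (@path_adj n).
Proof. by move=> i j; rewrite /path_adj orbC. Qed.

Lemma path_adj_irrefl n : irreflexive (@path_adj n).
Proof. by move=> i; rewrite /path_adj orbb gtn_eqF. Qed.

Definition path_graph (n : nat) : sgraph :=
  SGraph (@path_adj_sym n) (@path_adj_irrefl n).

(* The starlike tree with one pendent path of length l for each entry l of ls:
   [None] is the central vertex, and [Some (Tagged _ j)] with tag i is the
   vertex at distance j.+1 from the centre on the i-th pendent path. *)
Definition starlike_vertex (ls : seq nat) : finType :=
  option {i : 'I_(size ls) & 'I_(nth 0%N ls i)}.

Definition starlike_adj (ls : seq nat) : rel (starlike_vertex ls) :=
  fun u v =>
    match u, v with
    | None, None => false
    | None, Some y => tagged y == 0%N :> nat
    | Some x, None => tagged x == 0%N :> nat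
    | Some x, Some y =>
        (tag x == tag y) &&
        (((tagged x).+1 == tagged y :> nat) ||
         ((tagged y).+1 == tagged x :> nat))
    end.

Lemma starlike_adj_sym ls : symmetric (@starlike_adj ls).
Proof. by move=> [x|] [y|] //=; rewrite eq_sym orbC. Qed.

Lemma starlike_adj_irrefl ls : irreflexive (@starlike_adj ls).
Proof. by move=> [x|] //=; rewrite orbb gtn_eqF ?andbF. Qed.

Definition starlike (ls : seq nat) : sgraph :=
  SGraph (@starlike_adj_sym ls) (@starlike_adj_irrefl ls).

Lemma card_starlike ls : #|starlike ls| = (sumn ls).+1.
Proof.
rewrite card_option card_tagged; congr _.+1.
rewrite !sumnE big_map big_enum /= (big_nth 0%N) big_mkord.
by apply: eq_bigr => i _; rewrite card_ord.
Qed.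

(* The parameter range is 2 <= Delta <= n./2 with n even, where neither
   subtraction truncates. *)
Definition A_graph (n Delta : nat) : sgraph :=
  starlike [:: 1%N, (n - 2 * Delta + 2)%N & nseq (Delta - 2) 2%N].

Lemma card_A_graph n Delta :
  (2 <= Delta)%N -> (2 * Delta <= n)%N -> #|A_graph n Delta| = n.
Proof. by move=> h2 hn; rewrite card_starlike /= sumn_nseq; lia. Qed.

(* Main.v *)
Require Import Defs.
From HB Require Import structures.
From mathcomp Require Import all_boot all_order all_algebra.
From mathcomp Require Import fingroup perm zify ring.
Import Order.TTheory GRing.Theory Num.Theory.
Local Open Scope ring_scope.

(** Replacing [X] by [-X] in the characteristic polynomial turns the signed
    coefficients into honest ones: [c_k(G)] is the coefficient of degree [n - k]
    of [det (X + L(G))] ([laplacian_coefE]).  For a starlike tree with legs of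
    lengths [l_1, ..., l_d] this determinant is
      [X * prod_i p(l_i) + sum_i q(l_i) * prod_(i' <> i) p(l_i')],
    where [p(l)] is the determinant of the block of [X + L] carried by a leg of
    length [l], and [q(l) = p(l) - p(l - 1)]
    ([det_shifted_laplacian_starlike]).  It comes from Gaussian elimination from
    the leaves towards the centre: both the matrix recording the column
    operations and the resulting product are triangular for the order by
    distance to the centre, so their determinants are read off the diagonals.

    The tree for [Delta + 1] arises from the tree for [Delta] when the leg of
    length [m + 2] is split into legs of lengths [m] and [2].  The legs [m] and
    [2] around a centre form a path with [m + 3] vertices, as does the leg
    [m + 2] together with the centre; hence all terms in which the remaining
    legs [R] occur only through [prod_(l in R) p(l)] agree on both sides.  What
    remains is [(p(m + 2) - p(m) p(2)) * sum_(l in R) q(l) * ...], and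
    [p(m + 2) - p(m) p(2) = (X + 2) q(m)] ([starlike_poly_split2]).  The
    recurrence [q(l + 1) = X p(l) + q(l)] shows that [p] and [q] have nonnegative
    coefficients, so the difference does too.  For the equality, the path on
    [m + 1] vertices is the starlike tree with the single leg [m], and its
    polynomial equals that of the legs [1] and [m - 1]. *)

(** * Determinants *)

(** A permutation contributing to the Leibniz formula never lowers [h]; since it
    preserves the sum of all heights, it fixes every index. *)
Lemma det_height_triangular {R : comNzRingType} {n : nat} (A : 'M[R]_n)
    (h : 'I_n -> nat) :
  (forall i j, i != j -> A i j != 0 -> (h i < h j)%N) ->
  \det A = \prod_i A i i.
Proof.
move=> hA; rewrite /determinant (bigD1 (1%g : 'S_n)) //= odd_perm1 mul1r.
rewrite [X in _ + X]big1 ?addr0 => [|s s1].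
  by apply: eq_bigr => i _; rewrite perm1.
have [/existsP[i /eqP Ai0]|/existsPn nz] := boolP [exists i, A i (s i) == 0].
  by rewrite (bigD1 i) //= Ai0 mul0r mulr0.
case/eqP: s1; apply/permP => i; rewrite perm1; apply/esym/eqP.
have le_h (j : 'I_n) : true -> (h j <= h (s j) ?= iff (j == s j))%N.
  case: eqVneq => [<-|neq] _; first exact: leqif_refl.
  by have lt := hA _ _ neq (nz j); split; [exact: ltnW | rewrite ltn_eqF].
have [_] := leqif_sum le_h.
by rewrite [X in X == _](reindex_perm s) eqxx => /esym/forallP/(_ i).
Qed.

Lemma det_reindex {R : comNzRingType} {m n : nat} (s : 'I_m -> 'I_n)
    (A : 'M[R]_n) :
  bijective s -> \det (\matrix_(i, j) A (s i) (s j)) = \det A.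
Proof.
move=> bs; have eq_mn : m = n by rewrite -(card_ord m) -(card_ord n) (bij_eq_card bs).
case: n / eq_mn in s A bs *.
pose t := perm (bij_inj bs).
have -> : \matrix_(i, j) A (s i) (s j) = row_perm t (col_perm t A).
  by apply/matrixP => i j; rewrite !mxE !permE.
rewrite row_permE col_permE !det_mulmx !det_perm odd_permV.
by rewrite mulrC -mulrA -signr_addb addbb mulr1.
Qed.

(** * The polynomial with the Laplacian coefficients *)

Definition shifted_laplacian (G : sgraph) : 'M[{poly int}]_#|G| :=
  'X%:M + map_mx polyC (laplacian G).

Lemma coef_comp_polyNX (R : comNzRingType) (p : {poly R}) (n : nat) :
  (p \Po - 'X)`_n = (-1) ^+ n * p`_n.
Proof.
rewrite coef_comp_poly.
under eq_bigr => i _ do rewrite exprNn -polyC1 -polyCN -polyC_exp coefCM coefXn.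
case: (ltnP n (size p)) => hn.
  rewrite (bigD1 (Ordinal hn)) //= eqxx mulr1 mulrC big1 ?addr0 // => i.
  by rewrite -val_eqE /= eq_sym => /negbTE ->; rewrite !mulr0.
rewrite big1 ?[p`_n]nth_default ?mulr0 // => i _.
by rewrite gtn_eqF ?mulr0 // (leq_trans (ltn_ord i)).
Qed.

Lemma laplacian_coefE (G : sgraph) (n k : nat) :
  #|G| = n -> (k <= n)%N ->
  laplacian_coef G k = (\det (shifted_laplacian G))`_(n - k).
Proof.
move=> <- hk; rewrite /laplacian_coef.
have -> : \det (shifted_laplacian G) =
    ((-1) ^+ #|G|)%:P * (char_poly (laplacian G) \Po - 'X).
  rewrite /char_poly -[_ \Po _]/(comp_poly _ _) -det_map_mx polyC_exp.
  rewrite polyCN polyC1 -detZ; congr (\det _); apply/matrixP => i j.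
  rewrite !mxE /= comp_polyB comp_polyC rmorphMn /= comp_polyX.
  by rewrite mulN1r opprB mulNrn opprK addrC.
rewrite coefCM coef_comp_polyNX mulrA -exprD; congr (_ * _).
by rewrite -signr_odd -[RHS]signr_odd; congr (_ ^+ nat_of_bool _); lia.
Qed.

(** * Isomorphism invariance *)

Definition graph_iso {G H : sgraph} (f : G -> H) : Prop :=
  bijective f /\ forall u v, adj (f u) (f v) = adj u v.

Lemma degree_iso {G H : sgraph} {f : G -> H} (v : G) :
  graph_iso f -> degree (f v) = degree v.
Proof.
move=> [bf fE]; rewrite /degree -(card_imset _ (bij_inj bf)).
apply: eq_card => u; case: bf => g fK gK; rewrite -[u]gK mem_imset ?inE ?fE //.
exact: can_inj fK.
Qed.

Lemma det_shifted_laplacian_iso {G H : sgraph} (f : G -> H) :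
  graph_iso f ->
  \det (shifted_laplacian G) = \det (shifted_laplacian H).
Proof.
move=> isof; have [bf fE] := isof.
pose s (i : 'I_#|G|) := enum_rank (f (enum_val i)).
have bs : bijective s.
  apply: bij_comp (bij_comp bf _); [exact: enum_rank_bij|exact: enum_val_bij].
rewrite -(det_reindex _ _ bs); congr (\det _); apply/matrixP => i j.
by rewrite !mxE /s !enum_rankK fE (degree_iso _ isof) (bij_eq bs).
Qed.

(** Distributing the degree over the neighbours writes the Laplacian as a sum of
    differences along edges, so that the diagonal needs no separate treatment. *)
Lemma shifted_laplacian_apply (G : sgraph) (i : 'I_#|G|)
    (f : G -> {poly int}) :
  \sum_j shifted_laplacian G i j * f (enum_val j) =
  'X * f (enum_val i) +
    \sum_v (adj (enum_val i) v)%:R * (f (enum_val i) - f v).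
Proof.
set u := enum_val i.
transitivity ('X * f u + (degree u)%:R * f u - \sum_v (adj u v)%:R * f v).
  have -> : \sum_v (adj u v)%:R * f v =
      \sum_(j < #|G|) (adj u (enum_val j))%:R * f (enum_val j).
    by rewrite (reindex (enum_val : 'I_#|G| -> G)) //; apply: onW_bij; exact: enum_val_bij.
  transitivity (\sum_(j < #|G|) ((j == i)%:R * (('X + (degree u)%:R) * f u)
      - (adj u (enum_val j))%:R * f (enum_val j))).
    apply: eq_bigr => j _; rewrite !mxE -/u !rmorphB rmorphMn /= !rmorph_nat.
    rewrite eq_sym; case: eqVneq => [eij|_]; rewrite ?mulr1n ?mulr0n; last by ring.
    by rewrite /u -eij; ring.
  rewrite sumrB (bigD1 i) //= eqxx big1 => [|j /negbTE ->].
    by rewrite mul1r addr0 mulrDl.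
  exact: mul0r.
rewrite -addrA; congr (_ + _).
under [RHS]eq_bigr => v _ do rewrite mulrBr.
rewrite sumrB -mulr_suml -natr_sum; congr (_%:R * _ - _).
by rewrite /degree -sum1_card big_mkcond; apply: eq_bigr => v _; rewrite inE.
Qed.

(** * Leg polynomials *)

Local Notation nneg_poly := (polyOver (@Num.Def.nneg_num_pred int)).

(** [leg_shift l.+1] is the determinant of [X + L] restricted to a leg of length
    [l].  The index is shifted by one because the recurrence extends one step
    below length [0], with value [1]; this makes the end of a leg behave like an
    interior vertex. *)
Fixpoint leg_shift (n : nat) : {poly int} :=
  if n is n1.+1 then
    if n1 is n2.+1 then ('X + 2%:R) * leg_shift n1 - leg_shift n2 else 1
  else 1.
Arguments leg_shift : simpl never.

Definition leg_poly (l : nat) : {poly int} := leg_shift l.+1.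

(** Eliminating a leg of length [l] leaves [leg_diff l / leg_poly l] as its
    contribution to the diagonal entry of the centre. *)
Definition leg_diff (l : nat) : {poly int} := leg_shift l.+1 - leg_shift l.

Lemma leg_shiftSS n :
  leg_shift n.+2 = ('X + 2%:R) * leg_shift n.+1 - leg_shift n.
Proof. by []. Qed.

(** Unlike the three-term recurrence, this one has no minus sign; it is the
    source of all positivity. *)
Lemma leg_diffS l : leg_diff l.+1 = 'X * leg_shift l.+1 + leg_diff l.
Proof. by rewrite /leg_diff leg_shiftSS; ring. Qed.

Lemma leg_shift_diff_nneg l :
  (leg_shift l \is a nneg_poly) && (leg_diff l \is a nneg_poly).
Proof.
elim: l => [|l /andP[rl ql]].
  by rewrite /leg_diff /leg_shift subrr rpred0 rpred1.
have rl1 : leg_shift l.+1 \is a nneg_poly.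
  by rewrite -[leg_shift l.+1](subrK (leg_shift l)) rpredD.
by rewrite rl1 leg_diffS rpredD ?rpredM ?polyOverX.
Qed.

Lemma leg_poly_nneg l : leg_poly l \is a nneg_poly.
Proof. by case/andP: (leg_shift_diff_nneg l.+1). Qed.

Lemma leg_diff_nneg l : leg_diff l \is a nneg_poly.
Proof. by case/andP: (leg_shift_diff_nneg l). Qed.

Lemma leg_shift_neq0 n : leg_shift n != 0.
Proof.
suff: (leg_shift n).[0] = 1 /\ (leg_shift n.+1).[0] = 1.
  by case=> h _; apply: contra_eq_neq h => ->; rewrite horner0.
elim: n => [|n [IH0 IH1]]; first by rewrite /leg_shift hornerC.
by split=> //; rewrite leg_shiftSS !hornerE IH0 IH1.
Qed.

Lemma leg_shift_rec l t : (t < l)%N ->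
  ('X + 2%:R) * leg_shift (l.+1 - t.+1) - leg_shift (l.+1 - t) -
    leg_shift (l.+1 - t.+2) = 0.
Proof.
move=> lt_tl; have -> : (l.+1 - t = (l.+1 - t.+2).+2)%N by lia.
have -> : (l.+1 - t.+1 = (l.+1 - t.+2).+1)%N by lia.
by rewrite leg_shiftSS; ring.
Qed.

(** Along a leg, the two sides are the diagonal products for the image under
    [X + L] of the elimination matrix and for that matrix itself; their quotient
    telescopes to one leg polynomial. *)
Lemma prod_leg_shift l :
  \prod_(j < l) leg_shift (l.+1 - j) =
  leg_poly l * \prod_(j < l) leg_shift (l - j).
Proof.
transitivity (\prod_(j < l.+1) leg_shift (l.+1 - j)).
  by rewrite big_ord_recr /= subSnn mulr1.
by rewrite big_ord_recl /= subn0.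
Qed.

(** * The polynomial of a starlike tree *)

Fixpoint leg_sum (ls : seq nat) : {poly int} :=
  if ls is l :: ls' then
    leg_diff l * \prod_(l' <- ls') leg_poly l' + leg_poly l * leg_sum ls'
  else 0.

(** The determinant of [X + L] of the starlike tree, as shown by
    [det_shifted_laplacian_starlike]. *)
Definition starlike_poly (ls : seq nat) : {poly int} :=
  'X * \prod_(l <- ls) leg_poly l + leg_sum ls.

Lemma leg_sum_nneg ls : leg_sum ls \is a nneg_poly.
Proof.
elim: ls => [|l ls IH] /=; first exact: rpred0.
by rewrite rpredD ?rpredM ?rpred_prod ?leg_diff_nneg ?leg_poly_nneg // => *;
  exact: leg_poly_nneg.
Qed.

Lemma prod_leg_poly ls :
  \prod_(l <- ls) leg_poly l = \prod_(i < size ls) leg_poly (nth 0%N ls i).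
Proof. by rewrite (big_nth 0%N) big_mkord. Qed.

Lemma leg_sumE ls :
  leg_sum ls = \sum_(i < size ls) leg_diff (nth 0%N ls i) *
    \prod_(i' < size ls | i' != i) leg_poly (nth 0%N ls i').
Proof.
elim: ls => [|l ls IH] /=; first by rewrite big_ord0.
rewrite [RHS]big_ord_recl /=; congr (_ * _ + _).
  by rewrite [RHS]big_mkcond big_ord_recl /= mul1r prod_leg_poly.
rewrite IH mulr_sumr; apply: eq_bigr => i _.
rewrite mulrCA; congr (_ * _).
by rewrite [RHS]big_mkcond big_ord_recl [in LHS]big_mkcond.
Qed.

(** * Elimination from the leaves towards the centre *)

Lemma sum_ord_pick {R : comNzRingType} (m k : nat) (F : nat -> R) :
  \sum_(j < m) (j == k :> nat)%:R * F j = if (k < m)%N then F k else 0.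
Proof.
case: ltnP => hk.
  rewrite (bigD1 (Ordinal hk)) //= eqxx mul1r big1 ?addr0 // => j.
  by rewrite -val_eqE /= => /negbTE ->; rewrite mul0r.
by rewrite big1 // => j _; rewrite ltn_eqF ?mul0r // (leq_trans (ltn_ord j)).
Qed.

Section Starlike.
Variable ls : seq nat.
Hypothesis ls_gt0 : forall l, l \in ls -> (0 < l)%N.

Local Notation len i := (nth 0%N ls i).
Local Notation V := (starlike ls).

Definition on_leg (i : 'I_(size ls)) (j : 'I_(len i)) : V :=
  Some (Tagged (fun i0 : 'I_(size ls) => 'I_(len i0)) j).

Lemma starlike_ind (P : V -> Prop) :
  P None -> (forall i j, P (@on_leg i j)) -> forall v, P v.
Proof. by move=> P0 P1 [[i j]|]; [exact: P1 | exact: P0]. Qed.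

Lemma big_starlike (R : Type) (idx : R) (op : Monoid.com_law idx) (F : V -> R) :
  \big[op/idx]_v F v =
  op (F None) (\big[op/idx]_i \big[op/idx]_j F (@on_leg i j)).
Proof.
rewrite (bigD1 (None : V)) //=; congr (op _ _).
rewrite (@sig_big_dep _ _ _ _ (fun i : 'I_(size ls) => 'I_(len i)) _ _
  (fun i j => F (@on_leg i j))) /=.
rewrite (reindex_omap (fun y => Some y : V) id) /=; last by case.
by apply: eq_big => [y|[i j] _] //=; rewrite eqxx.
Qed.

(** The Laplacian acts on a function on the tree leg by leg, when the function is
    described on leg [i] by a sequence [g i] indexed by the distance to the
    centre. *)
Lemma laplacian_centre (f : V -> {poly int})
    (g : 'I_(size ls) -> nat -> {poly int}) :
  (forall i, g i 0%N = f None) ->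
  (forall i j, f (@on_leg i j) = g i j.+1) ->
  \sum_v (adj (None : V) v)%:R * (f None - f v) =
  \sum_i (g i 0%N - g i 1%N).
Proof.
move=> g0 gS; rewrite big_starlike /= mul0r add0r; apply: eq_bigr => i _.
under eq_bigr => j _ do rewrite gS.
rewrite (sum_ord_pick _ _ (fun j => f None - g i j.+1)) g0 ifT //.
by rewrite ls_gt0 ?mem_nth.
Qed.

(** Continuing [g i] past the leaf by repeating its last value makes the
    second difference correct at the leaf, which has degree one. *)
Lemma laplacian_leg (f : V -> {poly int})
    (g : 'I_(size ls) -> nat -> {poly int}) (i : 'I_(size ls)) (j : 'I_(len i)) :
  (forall i, g i 0%N = f None) ->
  (forall i j, f (@on_leg i j) = g i j.+1) ->
  g i (len i).+1 = g i (len i) ->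
  \sum_v (adj (on_leg i j) v)%:R * (f (on_leg i j) - f v) =
  2%:R * g i j.+1 - g i j - g i j.+2.
Proof.
move=> g0 gS gend; rewrite big_starlike /=.
rewrite (bigD1 i) //= [X in _ + (_ + X)]big1 ?addr0 => [|i' ne]; last first.
  by apply: big1 => j' _; rewrite eq_sym (negbTE ne) mul0r.
rewrite eqxx gS -(g0 i).
(* When [j] is [0], the index [j.-1] in the first sum is still in range although
   the neighbour towards the centre is then the centre itself; the factor
   [j != 0] discards it. *)
transitivity ((j == 0 :> nat)%:R * (g i j.+1 - g i 0%N) +
   (\sum_(j' < len i) (j' == j.-1 :> nat)%:R * ((j != 0 :> nat)%:R * (g i j.+1 - g i j'.+1)) +
   \sum_(j' < len i) (j' == j.+1 :> nat)%:R * (g i j.+1 - g i j'.+1))).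
  congr (_ + _); rewrite -big_split; apply: eq_bigr => j' _ /=.
  rewrite gS mulrA -mulrDl; congr (_ * _); rewrite -natrM -natrD; congr (_%:R).
  by lia.
rewrite (sum_ord_pick _ _ (fun k => (j != 0 :> nat)%:R * (g i j.+1 - g i k.+1))).
rewrite (sum_ord_pick _ _ (fun k => g i j.+1 - g i k.+1)).
have -> : (j.-1 < len i)%N by have := ltn_ord j; lia.
have -> : (if (j.+1 < len i)%N then g i j.+1 - g i j.+2 else 0)
    = g i j.+1 - g i j.+2.
  case: ltnP => // hj; have el : len i = j.+1 by have := ltn_ord j; lia.
  by case: j el {hj} => m /= _ el; move: gend; rewrite el => ->; rewrite subrr.
by case: (j : nat) => [|m] /=; ring.
Qed.

(** Column [w] of the elimination matrix along leg [i], at distance [t] from the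
    centre.  It satisfies the recurrence of the leg polynomials on the subtree
    of [w], so that [X + L] annihilates it strictly below [w].  In the column of
    the centre, the product over the other legs gives all legs a common value at
    distance [0]. *)
Definition leg_part (w : V) (i : 'I_(size ls)) (t : nat) : {poly int} :=
  if w is Some z then
    if (i == tag z) && (tagged z < t)%N then leg_shift ((len i).+1 - t) else 0
  else (\prod_(i' < size ls | i' != i) leg_poly (len i')) * leg_shift ((len i).+1 - t).

Definition elim_entry (v w : V) : {poly int} :=
  if v is Some y then leg_part w (tag y) (tagged y).+1
  else if w is Some z then 0 else \prod_(i < size ls) leg_poly (len i).

Lemma leg_part0 w i : leg_part w i 0 = elim_entry None w.
Proof.
case: w => [z|] /=; first by rewrite andbF.
by rewrite subn0 [RHS](bigD1 i) //= mulrC.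
Qed.

Lemma leg_part_end w i : leg_part w i (len i).+1 = leg_part w i (len i).
Proof.
case: w => [[i' j]|] /=; last by rewrite subnn subSnn.
case: eqVneq => //= ->; have := ltn_ord j => hj.
by rewrite hj ltnW // subnn subSnn.
Qed.

Definition depth (v : V) : nat := if v is Some y then (tagged y).+1 else 0%N.

(** The entries of [X + L] times the elimination matrix; see
    [mul_shifted_laplacian_elim]. *)
Definition elim_image (v w : V) : {poly int} :=
  'X * elim_entry v w + \sum_u (adj v u)%:R * (elim_entry v w - elim_entry u w).

Lemma elim_entry_depth v w :
  v != w -> elim_entry v w != 0 -> (depth w < depth v)%N.
Proof.
elim/starlike_ind: v => [|i j]; elim/starlike_ind: w => [|i' j'] //=.
  by rewrite eqxx.
case: (eqVneq i i') => [e|]; last by rewrite eqxx.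
case: i' / e j' => j' ne; case: ltnP; rewrite ?eqxx //= => le_jj _.
rewrite !ltnS in le_jj *; rewrite ltn_neqAle le_jj andbT.
by apply: contra ne => /eqP/val_inj ->.
Qed.

Lemma elim_image_leg i j w :
  elim_image (on_leg i j) w =
  ('X + 2%:R) * leg_part w i j.+1 - leg_part w i j - leg_part w i j.+2.
Proof.
rewrite /elim_image (@laplacian_leg _ (leg_part w)) //.
- by rewrite /=; ring.
- by move=> i'; exact: leg_part0.
- exact: leg_part_end.
Qed.

Lemma elim_image_centre :
  elim_image None None = starlike_poly ls.
Proof.
rewrite /elim_image (@laplacian_centre (elim_entry^~ None) (leg_part None)) //.
  rewrite /starlike_poly prod_leg_poly leg_sumE; congr (_ + _).
  by apply: eq_bigr => i _; rewrite /= -mulrBr mulrC subn0 subn1.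
by move=> i; exact: leg_part0.
Qed.

Lemma elim_image_diag i j :
  elim_image (on_leg i j) (on_leg i j) = leg_shift ((len i).+1 - j).
Proof.
rewrite elim_image_leg /= eqxx ltnn ltnSn ltnW //=.
by apply/eqP; rewrite subr0 -subr_eq0 -(leg_shift_rec _ _ (ltn_ord j)); apply/eqP; ring.
Qed.

(** Opposite to [elim_entry_depth]: a column vanishes outside the subtree of its
    vertex, but its image under [X + L] vanishes strictly inside it. *)
Lemma elim_image_depth v w :
  v != w -> elim_image v w != 0 -> (depth v < depth w)%N.
Proof.
elim/starlike_ind: v => [|i j].
  by elim/starlike_ind: w => [|i' j'] //=; rewrite eqxx.
move=> ne; rewrite elim_image_leg; apply: contraNT; rewrite -leqNgt.
elim/starlike_ind: w ne => [|i' j'] /= ne.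
  rewrite mulrCA -!mulrBr leg_shift_rec ?mulr0 //.
case: (eqVneq i i') => [e|]; last by rewrite mulr0 !subr0.
case: i' / e j' ne => j' ne; rewrite !ltnS => le_jj.
have lt_jj : (j' < j)%N.
  by rewrite ltn_neqAle le_jj andbT; apply: contra ne => /eqP/val_inj ->.
by rewrite lt_jj le_jj leqW //= leg_shift_rec.
Qed.

Definition elim_mx : 'M[{poly int}]_#|V| :=
  \matrix_(i, j) elim_entry (enum_val i) (enum_val j).

Lemma mul_shifted_laplacian_elim i j :
  (shifted_laplacian V *m elim_mx) i j = elim_image (enum_val i) (enum_val j).
Proof.
rewrite mxE; under eq_bigr => k _ do rewrite [elim_mx _ _]mxE.
exact: (shifted_laplacian_apply _ _ (fun v => elim_entry v (enum_val j))).
Qed.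

Lemma prod_enum_val (F : V -> {poly int}) :
  \prod_(i < #|V|) F (enum_val i) = \prod_v F v.
Proof.
rewrite [RHS](reindex (enum_val : 'I_#|V| -> V)) //.
by apply: onW_bij; exact: enum_val_bij.
Qed.

Lemma det_elim : \det elim_mx = \prod_v elim_entry v v.
Proof.
rewrite -det_tr -prod_enum_val (@det_height_triangular _ _ _ (depth \o enum_val)).
  by apply: eq_bigr => i _; rewrite !mxE.
move=> i j ne; rewrite !mxE; apply: elim_entry_depth.
by rewrite (inj_eq enum_val_inj) eq_sym.
Qed.

Lemma det_mul_elim :
  \det (shifted_laplacian V *m elim_mx) = \prod_v elim_image v v.
Proof.
rewrite -prod_enum_val (@det_height_triangular _ _ _ (depth \o enum_val)).
  by apply: eq_bigr => i _; rewrite mul_shifted_laplacian_elim.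
move=> i j ne; rewrite mul_shifted_laplacian_elim; apply: elim_image_depth.
by rewrite (inj_eq enum_val_inj).
Qed.

Lemma det_shifted_laplacian_starlike :
  \det (shifted_laplacian V) = starlike_poly ls.
Proof.
have nz : \det elim_mx != 0.
  rewrite det_elim; apply/prodf_neq0 => v _; elim/starlike_ind: v => [|i j] /=.
    by apply/prodf_neq0 => i _; exact: leg_shift_neq0.
  by rewrite eqxx ltnSn; exact: leg_shift_neq0.
apply: (mulIf nz); rewrite -det_mulmx det_mul_elim det_elim !big_starlike /=.
rewrite elim_image_centre; congr (_ * _).
rewrite -big_split; apply: eq_bigr => i _ /=; rewrite eqxx /=.
under [X in _ = _ * X]eq_bigr => j _ do rewrite ltnSn subSS.
by rewrite -prod_leg_shift; apply: eq_bigr => j _; rewrite elim_image_diag.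
Qed.

End Starlike.

(** * Splitting a leg, and the path *)

(** The terms divisible by the product of [leg_poly] over [a :: ls] cancel,
    because the legs [m] and [2] around a centre make the same path as a single
    leg [m.+2] with its centre. *)
Lemma starlike_poly_split2 (a m : nat) (ls : seq nat) :
  starlike_poly [:: a, m.+2 & ls] =
  starlike_poly [:: a, m, 2%N & ls] +
    ('X + 2%:R) * leg_diff m * leg_sum (a :: ls).
Proof.
rewrite /starlike_poly /= !big_cons /leg_poly /leg_diff !leg_shiftSS.
rewrite [leg_shift 1]/leg_shift [leg_shift 0]/leg_shift; ring.
Qed.

(** Both sides describe the path with [m.+2] vertices, rooted at the neighbour
    of an end and at an end. *)
Lemma starlike_poly_path (m : nat) :
  starlike_poly [:: 1%N; m] = starlike_poly [:: m.+1].
Proof.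
rewrite /starlike_poly /= !big_cons !big_nil.
rewrite /leg_poly /leg_diff !leg_shiftSS.
rewrite [leg_shift 1]/leg_shift [leg_shift 0]/leg_shift; ring.
Qed.

Definition path_to_starlike (m : nat) (i : path_graph m.+1) :
    starlike [:: m] :=
  if unlift ord0 i is Some j then on_leg [:: m] ord0 j else None.

Lemma path_starlike_iso (m : nat) : graph_iso (path_to_starlike m).
Proof.
have f0 : path_to_starlike m ord0 = None.
  by rewrite /path_to_starlike unlift_none.
have fS j : path_to_starlike m (lift ord0 j) = on_leg [:: m] ord0 j.
  by rewrite /path_to_starlike liftK.
split.
  apply: inj_card_bij; last by rewrite card_starlike /= addn0 card_ord.
  move=> u v; case: (unliftP ord0 u) => [i|] ->;
    case: (unliftP ord0 v) => [j|] ->; rewrite ?f0 ?fS => e //=;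
    have := congr1 (depth [:: m]) e => //=.
  by move=> [] /val_inj ->.
move=> u v; case: (unliftP ord0 u) => [i|] ->;
  case: (unliftP ord0 v) => [j|] ->; rewrite ?f0 ?fS /=;
  rewrite ?eqxx /path_adj /= /bump; lia.
Qed.

Lemma laplacian_coef_path (m k : nat) :
  (0 < m)%N -> (k <= m.+1)%N ->
  laplacian_coef (path_graph m.+1) k = (starlike_poly [:: m])`_(m.+1 - k).
Proof.
move=> m0 hk; rewrite (laplacian_coefE (path_graph m.+1) _ _ (card_ord _) hk).
rewrite (det_shifted_laplacian_iso _ (path_starlike_iso m)).
by rewrite det_shifted_laplacian_starlike // => l; rewrite inE => /eqP ->.
Qed.

Lemma laplacian_coef_A (n Delta k : nat) :
  (2 <= Delta)%N -> (2 * Delta <= n)%N -> (k <= n)%N ->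
  laplacian_coef (A_graph n Delta) k =
  (starlike_poly
     [:: 1%N, (n - 2 * Delta + 2)%N & nseq (Delta - 2) 2%N])`_(n - k).
Proof.
move=> h2 hn hk; rewrite (laplacian_coefE _ _ _ (card_A_graph h2 hn) hk).
rewrite det_shifted_laplacian_starlike // => l; rewrite !inE.
by move=> /or3P[/eqP->|/eqP->|/nseqP[->]] //; rewrite addn2.
Qed.

(** * Comparison of the trees *)

Theorem mainTheorem9 (n : nat) (hn : (4 <= n)%N) (heven : ~~ odd n)
    (k : nat) (hk : (k <= n)%N) :
  (forall Delta : nat, (2 <= Delta)%N -> (Delta.+1 <= n./2)%N ->
     laplacian_coef (A_graph n Delta.+1) k <= laplacian_coef (A_graph n Delta) k)
  /\ laplacian_coef (A_graph n 2) k = laplacian_coef (path_graph n) k.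
Proof.
split=> [Delta h2 hD|].
  rewrite !laplacian_coef_A //; try lia.
  have -> : (n - 2 * Delta + 2 = (n - 2 * Delta.+1 + 2).+2)%N by lia.
  have -> : (Delta.+1 - 2 = (Delta - 2).+1)%N by lia.
  rewrite [nseq _.+1 _]/= starlike_poly_split2 [X in _ <= X]coefD lerDl.
  set d := _ * leg_sum _; suff /polyOverP/(_ (n - k)%N) : d \is a nneg_poly by [].
  apply: rpredM; last exact: leg_sum_nneg.
  apply: rpredM; last exact: leg_diff_nneg.
  by rewrite rpredD ?polyOverX ?rpred_nat.
case: n hn {heven} hk => // m hm hk.
rewrite laplacian_coef_A // laplacian_coef_path; try lia.
rewrite starlike_poly_path.
by have -> : ((m.+1 - 2 * 2 + 2).+1 = m)%N by lia.
Qed.
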